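(* Let $L/K$ be a finite Galois extension of number fields, $\rho:\mathrm{Gal}(L/K)\to\mathrm{GL}(V)$ a finite-dimensional complex representation and $\lambda^\bullet\in\mathbb{Y}_K$. Then $$\mathrm{Tr}_{\widetilde{\mathbb{H}}_{\lambda^\bullet}(W_\rho)}(\sigma_K)=\sum_{\mathrm{content}(T^\bullet)=\lambda^\bullet}\mathrm{cocharge}(T^\bullet)\,\mathrm{Tr}_{\mathbb{S}_{\mathrm{sh}(T^\bullet)}(W_\rho)}(\sigma_K),$$ where $T^\bullet$ ranges over semi-standard arithmetic Young tableaux with content $\lambda^\bullet$.
   Context: For a number field $K$ with ring of integers $\mathcal{O}_K$, $\mathbb{P}_K$ is the set of (nonzero) prime ideals, $N(\mathfrak{q})=|\mathcal{O}_K/\mathfrak{q}|$. $\mathbb{Y}_K$ is the set of tuples $\lambda^\bullet=(\lambda^{(\mathfrak{q})})_{\mathfrak{q}\in\mathbb{P}_K}$ of partitions, almost all empty. For each $\mathfrak{q}\in\mathbb{P}_K$ choose a prime $\mathfrak{p}$ of $L$ over $\mathfrak{q}$; let $I(\mathfrak{q})\subset D(\mathfrak{q})\subset\mathrm{Gal}(L/K)$ be its inertia and decomposition groups and $\sigma_{\mathfrak{q}}\in D(\mathfrak{q})/I(\mathfrak{q})$ the Frobenius element. $G_{L/K}:=\prod_{\mathfrak{q}\in\mathbb{P}_K}N_{\mathrm{Gal}(L/K)}(I(\mathfrak{q}))/I(\mathfrak{q})$, where $N_G(H)$ is the normalizer; $\sigma_K:=(\sigma_{\mathfrak{q}})_{\mathfrak{q}}\in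 G_{L/K}$. $V_{\mathfrak{q}}$ is the fixed space $V^{I(\mathfrak{q})}$ on which $G_{L/K}$ acts through its $\mathfrak{q}$-component. $W_\rho:=\bigotimes_{\mathfrak{q}}V_{\mathfrak{q}}$ (a factored representation). For a partition $\mu$, $\mathbb{S}_\mu(W)=W^{\otimes|\mu|}\otimes_{\mathfrak{S}_{|\mu|}}S^\mu$ is the Schur functor ($\mathbb{S}_{(m)}=\mathrm{Sym}^m$, $\mathbb{S}_\emptyset$ trivial one-dimensional), and $\mathbb{S}_{\mu^\bullet}(W_\rho):=\bigotimes_{\mathfrak{q}}\mathbb{S}_{\mu^{(\mathfrak{q})}}(V_{\mathfrak{q}})$. For a partition $\lambda$ and $m\in\mathbb{N}$, $\widetilde{\mathbb{H}}_\lambda(W;m):=\bigoplus_{\mathrm{content}(T)=\lambda}\mathbb{S}_{\mathrm{sh}(T)}(W)^{\oplus m^{\mathrm{cocharge}(T)}}$, where $T$ ranges over semi-standard Young tableaux of any shape $\mathrm{sh}(T)$ having exactly $\lambda_i$ entries equal to $i$ for each $i$; $\widetilde{\mathbb{H}}_{\lambda^\bullet}(W_\rho):=\bigotimes_{\mathfrak{q}}\widetilde{\mathbb{H}}_{\lambda^{(\mathfrak{q})}}(V_{\mathfrak{q}};N(\mathfrak{q}))$, a finite-dimensional representation of $G_{L/K}$. A semi-standard arithmetic Young tableau is a tuple $T^\bullet=(T^{(\mathfrak{q})})_{\mathfrak{q}\in\mathbb{P}_K}$ of semi-standard Young tableaux with $\mathrm{sh}(T^{(\mathfrak{q})})=\emptyset$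 for all but finitely many $\mathfrak{q}$; $\mathrm{sh}(T^\bullet)=(\mathrm{sh}(T^{(\mathfrak{q})}))_{\mathfrak{q}}$, $\mathrm{content}(T^\bullet)=(\mathrm{content}(T^{(\mathfrak{q})}))_{\mathfrak{q}}$, and $\mathrm{cocharge}(T^\bullet):=\prod_{\mathfrak{q}}N(\mathfrak{q})^{\mathrm{cocharge}(T^{(\mathfrak{q})})}\in\mathbb{N}$. Cocharge of a single tableau (Lascoux–Schützenberger): $\mathrm{cocharge}(T)=n(\lambda)-\mathrm{charge}(T)$ for $T$ of content $\lambda$, $n(\lambda)=\sum_{i\ge1}(i-1)\lambda_i$. Here charge is defined on the word $w(T)$ obtained by reading $T$ (English notation) right to left in each row, rows from top to bottom. For a standard word (each of $1,\dots,r$ once) give $1$ index $0$, and if $k$ has index $i$ then $k+1$ has index $i$ if it is to the right of $k$ and $i+1$ if it is to the left; charge is the sum of the indices. For a word of partition content, extract a standard subword by choosing the first $1$ from the left, then the first $2$ to the right of it, and so on, returning to the beginning of the word whenever there is no $k+1$ to the right of the chosen $k$; erase it and repeat; charge is the sum of the charges of these standard subwords. *)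

(* Defs.v *)
From HB Require Import structures.
From mathcomp Require Import all_boot all_order all_algebra all_fingroup.
From mathcomp Require Import all_solvable all_field all_character.
From mathcomp Require Import ring_quotient finmap.
From mathcomp Require Import boolp classical_sets functions cardinality fsbigop.
From mathcomp Require Import reals complex.

Set Implicit Arguments.
Unset Strict Implicit.
Unset Printing Implicit Defensive.

Import GRing.Theory Num.Theory.

Local Open Scope ring_scope.

Definition is_partition (s : seq nat) : bool := sorted geq s && (0%N \notin s).

Record partition :=
  Partition { parts :> seq nat; partsP : is_partition parts }.
HB.instance Definition _ := [isSub for parts].
HB.instance Definition _ := [Choice of partition by <:].

Definition empty_partition : partition := @Partition [::] isT.

(* A tableau is the list of its rows, from top to bottom (English notation);  *)
(* [zip] stops at the end of the lower, shorter row.                          *)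
Definition is_ssyt (T : seq (seq nat)) : bool :=
  [&& is_partition (map size T),
      all (fun r => 0%N \notin r) T,
      all (sorted leq) T
    & sorted (fun r r' => all (fun p => p.1 < p.2)%N (zip r r')) T].

Record tableau := Tableau { rows :> seq (seq nat); rowsP : is_ssyt rows }.
HB.instance Definition _ := [isSub for rows].
HB.instance Definition _ := [Choice of tableau by <:].

Definition empty_tableau : tableau := @Tableau [::] isT.

Lemma tableau_shape_subproof (T : tableau) : is_partition (map size T).
Proof. by have /and4P[] := rowsP T. Qed.

Definition tableau_shape (T : tableau) : partition :=
  Partition (tableau_shape_subproof T).

(* The [i]-th item (from 0) counts the entries equal to [i.+1]; the list      *)
(* stops at the largest entry, so that it has no trailing zero.               *)
Definition tableau_content (T : seq (seq nat)) : seq nat :=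
  mkseq (fun i => count_mem i.+1 (flatten T)) (\max_(x <- flatten T) x).

Definition reading_word (T : seq (seq nat)) : seq nat := flatten (map rev T).

(* [w] is a standard word; the index of 1 is 0.                               *)
Fixpoint std_index (w : seq nat) (k : nat) : nat :=
  if k is k'.+1 then
    (std_index w k' + ((0 < k') && (index k w < index k' w)))%N
  else 0%N.

Definition std_charge (w : seq nat) : nat :=
  (\sum_(1 <= k < (size w).+1) std_index w k)%N.

(* The position of the first [k] at or after position [i], or else of the     *)
(* first [k] of the whole word.                                               *)
Definition cyclic_index (w : seq nat) (i k : nat) : nat :=
  if k \in drop i w then (i + index k (drop i w))%N else index k w.

(* The positions of the letters [k], [k.+1], ... chosen by a cyclic search    *)
(* starting at position [i]; [fuel] bounds the number of letters.             *)
Fixpoint std_positions (w : seq nat) (fuel i k : nat) : seq nat :=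
  if fuel is fuel'.+1 then
    if k \in w then
      let p := cyclic_index w i k in p :: std_positions w fuel' p.+1 k.+1
    else [::]
  else [::].

Definition std_mask (w : seq nat) : bitseq :=
  let ps := std_positions w (size w) 0 1 in
  mkseq (fun i => i \in ps) (size w).

Definition std_subword (w : seq nat) : seq nat := mask (std_mask w) w.

Definition erase_std_subword (w : seq nat) : seq nat :=
  mask (map negb (std_mask w)) w.

(* Each round erases at least the letter 1 of a nonempty word of partition    *)
(* content, so [size w] rounds exhaust the word.                              *)
Fixpoint charge_rec (fuel : nat) (w : seq nat) : nat :=
  if fuel is fuel'.+1 then
    (std_charge (std_subword w) + charge_rec fuel' (erase_std_subword w))%N
  else 0%N.

Definition word_charge (w : seq nat) : nat := charge_rec (size w) w.

Definition tableau_charge (T : seq (seq nat)) : nat :=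
  word_charge (reading_word T).

Definition partition_n (la : seq nat) : nat :=
  (\sum_(i < size la) i * nth 0 la i)%N.

(* The truncated subtraction is exact when the content of [T] is a partition, *)
(* as the charge is then at most [partition_n (tableau_content T)].           *)
Definition tableau_cocharge (T : seq (seq nat)) : nat :=
  (partition_n (tableau_content T) - tableau_charge T)%N.

(* In MathComp [(s * t)%g i = t (s i)] and representations act on row vectors *)
(* from the right, so a [mx_representation] of ['S_m] is a left module for    *)
(* the group law given by composition of functions.                           *)

Section Specht.

Variables (C : fieldType) (mu : seq nat).
Local Notation m := (sumn mu).

(* The boxes of the diagram of [mu] are numbered row by row: box [i] lies in  *)
(* row [reshape_index mu i] and column [reshape_offset mu i].                 *)
Definition row_stabiliser : {set 'S_m} :=
  [set s : 'S_m |
    [forall i : 'I_m, reshape_index mu (s i) == reshape_index mu i]]%SET.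

Definition col_stabiliser : {set 'S_m} :=
  [set s : 'S_m |
    [forall i : 'I_m, reshape_offset mu (s i) == reshape_offset mu i]]%SET.

(* The Young symmetrizer, i.e. the sum of [(-1)^q (p \o q)].                  *)
Definition young_symmetrizer : 'rV[C]_(gcard [set: 'S_m]%G) :=
  \sum_(p in row_stabiliser) \sum_(q in col_stabiliser)
    (-1) ^+ odd_perm q *: delta_mx 0 (gring_index [set: 'S_m]%G (q * p)%g).

(* The ideal of the group algebra generated by the Young symmetrizer.         *)
Definition specht_ideal :=
  cyclic_mx (regular_repr C [set: 'S_m]%G) young_symmetrizer.

Definition specht_repr :
    mx_representation C [set: 'S_m]%G (\rank specht_ideal) :=
  submod_repr (cyclic_mx_module (regular_repr C [set: 'S_m]%G)
                                young_symmetrizer).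

End Specht.

Section TensorPower.

Variables (C : fieldType) (m d : nat).

(* The basis of the [m]-th tensor power of ['rV_d] is indexed by the          *)
(* functions [f : 'I_m -> 'I_d], for the tensors                              *)
(* [e_(f 0) (x) ... (x) e_(f (m - 1))].                                       *)
Definition tensor_dim : nat := #|{ffun 'I_m -> 'I_d}|.

Definition tensor_mx (A : 'M[C]_d) : 'M[C]_tensor_dim :=
  \matrix_(a, b) \prod_(i < m)
    A ((enum_val a : {ffun 'I_m -> 'I_d}) i)
      ((enum_val b : {ffun 'I_m -> 'I_d}) i).

(* [s] moves the tensor factor in position [i] to position [s i].             *)
Definition place_mx (s : 'S_m) : 'M[C]_tensor_dim :=
  \matrix_(a, b)
    (enum_val b ==
      [ffun i => (enum_val a : {ffun 'I_m -> 'I_d}) ((s^-1)%g i)])%:R.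

Lemma tensor_mx1 : tensor_mx 1%:M = 1%:M.
Proof.
apply/matrixP => a b; rewrite !mxE.
have [<-|nab] := eqVneq a b; first by rewrite big1 // => i _; rewrite mxE eqxx.
have /existsP[i ni] : [exists i, enum_val a i != enum_val b i].
  apply: contra_neqT nab; rewrite negb_exists => /forallP eab.
  by apply/enum_val_inj/ffunP => i; apply/eqP; rewrite -[_ == _]negbK eab.
by rewrite (bigD1 i) //= mxE (negPf ni) mul0r.
Qed.

Lemma tensor_mxM A B : tensor_mx (A *m B) = tensor_mx A *m tensor_mx B.
Proof.
apply/matrixP => a b; rewrite !mxE.
under eq_bigr do rewrite mxE.
rewrite bigA_distr_bigA /=.
rewrite (reindex (fun k : 'I_tensor_dim => enum_val k)) /=; last first.
  exact/onW_bij/enum_val_bij.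
by apply: eq_bigr => k _; rewrite !mxE -big_split.
Qed.

Lemma place_tensorC s A : place_mx s *m tensor_mx A = tensor_mx A *m place_mx s.
Proof.
apply/matrixP => a b; rewrite !mxE.
pose fa : {ffun 'I_m -> 'I_d} := [ffun i => enum_val a ((s^-1)%g i)].
pose fb : {ffun 'I_m -> 'I_d} := [ffun i => enum_val b (s i)].
rewrite (bigD1 (enum_rank fa)) //= [X in _ + X]big1 ?addr0; last first.
  move=> k nk; rewrite !mxE; case: eqP => [ek|]; last by rewrite mul0r.
  by case/eqP: nk; apply: enum_val_inj; rewrite enum_rankK ek.
rewrite (bigD1 (enum_rank fb)) //= [X in _ = _ + X]big1 ?addr0; last first.
  move=> k nk; rewrite !mxE; case: eqP => [ek|]; last by rewrite mulr0.
  case/eqP: nk; apply: enum_val_inj; rewrite enum_rankK.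
  by apply/ffunP => i; rewrite ffunE ek ffunE permK.
rewrite !mxE !enum_rankK eqxx mul1r.
rewrite (_ : _ == _) ?mulr1; last first.
  by apply/eqP/ffunP => i; rewrite !ffunE permKV.
rewrite (reindex_inj (@perm_inj _ s)) /=.
by apply: eq_bigr => i _; rewrite !ffunE permK.
Qed.

End TensorPower.

Section Schur.

Variables (C : fieldType) (gT : finGroupType) (G : {group gT}).
Variables (mu : seq nat) (W : representation C G).
Local Notation m := (sumn mu).
Local Notation d := (rdegree W).
Local Notation S := (specht_repr C mu).
Local Notation N := (tensor_dim m d * \rank (specht_ideal C mu))%N.

Lemma tensor_specht_subproof :
  mx_repr G (fun g => tprod (tensor_mx m (W g)) 1%:M : 'M[C]_N).
Proof.
split=> [|g h Gg Gh]; first by rewrite repr_mx1 tensor_mx1 tprod1.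
by rewrite repr_mxM // tensor_mxM -tprodE mulmx1.
Qed.

(* [G] acts on W^(x)m (x) S^mu through the first factor.                      *)
Definition tensor_specht_repr : mx_representation C G N :=
  MxRepresentation tensor_specht_subproof.

(* Tensoring over C[S_m] divides by the span of the vectors                   *)
(* [s w (x) s v - w (x) v], which is that of the [w s (x) v - w (x) s v] for  *)
(* the right action [w s = s^-1 w] on tensors.                                *)
Definition balancing : 'M[C]_N :=
  (\sum_(s : 'S_m) (tprod (place_mx C d s) (S s) - 1%:M : 'M[C]_N))%MS.

Lemma balancing_module : mxmodule tensor_specht_repr balancing.
Proof.
apply/mxmoduleP => g Gg; rewrite sumsmxMr.
apply/sumsmx_subP => s _; apply: (sumsmx_sup s) => //=.
rewrite mulmxBl mul1mx -tprodE place_tensorC mulmx1.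
rewrite -[X in tprod _ X - _]mul1mx tprodE -[X in _ - X]mulmx1 -mulmxBr.
exact: submxMl.
Qed.

Definition schur_functor : representation C G :=
  Representation (factmod_repr balancing_module).

End Schur.

Definition Htilde (C : fieldType) (gT : finGroupType) (G : {group gT})
    (la : partition) (W : representation C G) (m : nat) : representation C G :=
  \big[@dadd_grepr C gT G/grepr0]_(T <- fset_set
      [set T : tableau | tableau_content T = la]%classic)
    muln_grepr (schur_functor (tableau_shape T) W) (m ^ tableau_cocharge T)%N.

Section RingOfIntegers.

Variable F : fieldType.

Definition algebraic_integer : {pred F} :=
  fun x => `[< integralOver (intr : int -> F) x >].

Lemma integralP x :
  reflect (integralOver (intr : int -> F) x) (x \in algebraic_integer).
Proof. exact: asboolP. Qed.

Lemma integral_subring : subring_closed algebraic_integer.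
Proof.
split=> [|x y /integralP ix /integralP iy|x y /integralP ix /integralP iy].
- exact/integralP/integral1.
- exact/integralP/integral_sub.
- exact/integralP/integral_mul.
Qed.
HB.instance Definition _ := GRing.isSubringClosed.Build F algebraic_integer
  integral_subring.

Record int_ring :=
  IntRing { int_val : F; int_valP : int_val \in algebraic_integer }.
HB.instance Definition _ := [isSub for int_val].
HB.instance Definition _ := [Choice of int_ring by <:].
HB.instance Definition _ := [SubChoice_isSubComNzRing of int_ring by <:].

Record prime_ideal := PrimeIdeal {
  ideal_fun : int_ring -> bool;
  ideal_closed : idealr_closed ideal_fun;
  ideal_prime : prime_idealr_closed ideal_fun;
  ideal_neq0 : exists2 x, x \in ideal_fun & x != 0
}.

Definition ideal_pred (q : prime_ideal) : {pred int_ring} := ideal_fun q.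
Coercion ideal_pred : prime_ideal >-> pred_sort.

HB.instance Definition _ (q : prime_ideal) :=
  isIdealr.Build int_ring (ideal_pred q) (ideal_closed q).
HB.instance Definition _ (q : prime_ideal) :=
  isPrimeIdealrClosed.Build int_ring (ideal_pred q) (ideal_prime (p := q)).

Definition absolute_norm (q : prime_ideal) : nat :=
  #|` fset_set [set: {ideal_quot (ideal_pred q)}]%classic|.

End RingOfIntegers.

HB.instance Definition _ (F : fieldType) := gen_eqMixin (prime_ideal F).
HB.instance Definition _ (F : fieldType) := gen_choiceMixin (prime_ideal F).

Definition lies_over (K : fieldType) (L : fieldExtType K)
    (p : prime_ideal L) (q : prime_ideal K) : Prop :=
  forall (x : int_ring K) (y : int_ring L),
    int_val y = (int_val x)%:A -> (x \in q) = (y \in p).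

Section Ramification.

Variables (K : fieldType) (L : splittingFieldType K).
Implicit Types (g h : gal_of {:L}) (x : int_ring L) (p : prime_ideal L).

Lemma gal_int_subproof g x : g (int_val x) \in @algebraic_integer L.
Proof.
case: x => x /= /integralP ix; apply/integralP.
have [q q_monic qx0] := integral_rmorph (g : {rmorphism L -> L}) ix.
exists q => //; congr (root _ _): qx0; apply: eq_map_poly => z /=.
exact: rmorph_int.
Qed.

Definition gal_int g x : int_ring L := IntRing (gal_int_subproof g x).

Lemma gal_int1 x : gal_int 1%g x = x.
Proof. by apply: val_inj; rewrite /= gal_id. Qed.

Lemma gal_intM g h x : gal_int (g * h)%g x = gal_int h (gal_int g x).
Proof. by apply: val_inj; rewrite /= galM ?memvf. Qed.

Definition decomposition_group p : {set gal_of {:L}} :=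
  [set g in 'Gal({:L} / 1)%g |
    `[< forall x, (gal_int g x \in p) = (x \in p) >]]%SET.

Lemma decomposition_group_set p : group_set (decomposition_group p).
Proof.
apply/group_setP; split=> [|g h].
  by rewrite inE group1; apply/asboolP => x; rewrite gal_int1.
rewrite !inE => /andP[Gg /asboolP Dg] /andP[Gh /asboolP Dh].
by rewrite groupM //; apply/asboolP => x; rewrite gal_intM Dh.
Qed.
Canonical decomposition_group_group p := Group (decomposition_group_set p).

Definition inertia_group p : {set gal_of {:L}} :=
  [set g in decomposition_group p | `[< forall x, gal_int g x - x \in p >]]%SET.

Lemma inertia_group_set p : group_set (inertia_group p).
Proof.
apply/group_setP; split=> [|g h].
  rewrite inE group1; apply/asboolP => x; rewrite gal_int1 subrr.
  exact: (idealr0 (ideal_pred p)).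
case/setIdP=> Dg /asboolP Ig /setIdP[Dh /asboolP Ih]; apply/setIdP.
split; first exact: (@groupM _ (decomposition_group_group p)).
apply/asboolP => x; rewrite gal_intM.
rewrite -(subrK (gal_int g x) (gal_int h _)) -addrA.
exact: (@rpredD _ (ideal_pred p) _ _ (Ih _) (Ig _)).
Qed.
Canonical inertia_group_group p := Group (inertia_group_set p).

Lemma inertia_group_sub p : inertia_group p \subset 'Gal({:L} / 1)%g.
Proof. by apply/fintype.subsetP => g; rewrite !inE => /andP[/andP[]]. Qed.

Definition local_group p : {group coset_of (inertia_group p)} :=
  ('N_('Gal({:L} / 1))(inertia_group p) / inertia_group p)%G.

(* [c] is the class of an element of the decomposition group which acts on    *)
(* the residue field of [p] as the power [N].                                 *)
Definition is_frobenius p (N : nat) (c : coset_of (inertia_group p)) : Prop :=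
  exists2 g, g \in decomposition_group p &
    coset (inertia_group p) g = c /\ forall x, gal_int g x - x ^+ N \in p.

Section InertiaInvariants.

Variables (C : fieldType) (n : nat).
Variables (rho : mx_representation C 'Gal({:L} / 1)%G n) (p : prime_ideal L).
Local Notation I := (inertia_group_group p).
Local Notation G := 'Gal({:L} / 1)%G.

Let rhoN := subg_repr rho (finset.subsetIl G 'N(I)%g).

Lemma invariants_module : mxmodule rhoN (rfix_mx rho I).
Proof.
rewrite /mxmodule rstabs_subg finset.subsetI subxx.
exact/norm_sub_rstabs_rfix_mx/inertia_group_sub.
Qed.

Let V_I := submod_repr invariants_module.

Lemma inertia_sub_rker : I \subset rker V_I.
Proof.
have sIN : I \subset ('N_G(I))%g.
  by rewrite finset.subsetI inertia_group_sub normG.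
apply/fintype.subsetP => g Ig.
rewrite /rker inE (fintype.subsetP sIN) //= mul1mx.
have fixV := elimT (rfix_mxP (rG := rho) I) (val_submodP 1%:M).
by rewrite /submod_mx /= (fixV g Ig) val_submodK.
Qed.

Definition inertia_invariants : representation C (local_group p) :=
  Representation (quo_repr inertia_sub_rker (finset.subsetIr G 'N(I)%g)).

End InertiaInvariants.

End Ramification.

Section GroupRep.

Variables (C : fieldType) (H : groupType).

Record group_rep := GroupRep {
  rep_dim : nat;
  rep_mx :> H -> 'M[C]_rep_dim;
  rep_mx1 : rep_mx 1%g = 1%:M;
  rep_mxM : {morph rep_mx : x y / (x * y)%g >-> x *m y}
}.

Lemma unit_rep_subproof : {morph (fun=> 1%:M : 'M[C]_1) :
  x y / (x * y : H)%g >-> x *m y}.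
Proof. by move=> x y; rewrite mulmx1. Qed.

Definition unit_rep : group_rep := GroupRep erefl unit_rep_subproof.

Section Tensor.

Variables V W : group_rep.

Lemma tensor_rep_subproof1 : tprod (V 1%g) (W 1%g) = 1%:M.
Proof. by rewrite !rep_mx1 tprod1. Qed.

Lemma tensor_rep_subproofM :
  {morph (fun x => tprod (V x) (W x)) : x y / (x * y)%g >-> x *m y}.
Proof. by move=> x y; rewrite !rep_mxM tprodE. Qed.

Definition tensor_rep : group_rep :=
  GroupRep tensor_rep_subproof1 tensor_rep_subproofM.

End Tensor.

Definition trace_rep (V : group_rep) (x : H) : C := \tr (V x).

End GroupRep.

Definition group_product (I : Type) (H : I -> groupType) : Type :=
  forall i, H i.

Section GroupProduct.

Variables (I : Type) (H : I -> groupType).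
Implicit Types x y z : group_product H.

HB.instance Definition _ := gen_eqMixin (group_product H).
HB.instance Definition _ := gen_choiceMixin (group_product H).

Let one : group_product H := fun=> 1%g.
Let inv x : group_product H := fun i => (x i)^-1%g.
Let mul x y : group_product H := fun i => (x i * y i)%g.

Lemma group_product_mulA : associative mul.
Proof.
move=> x y z; apply: functional_extensionality_dep => i; exact: mulgA.
Qed.

Lemma group_product_mul1 : left_id one mul.
Proof.
move=> x; apply: functional_extensionality_dep => i; exact: mul1g.
Qed.

Lemma group_product_1mul : right_id one mul.
Proof.
move=> x; apply: functional_extensionality_dep => i; exact: mulg1.
Qed.

Lemma group_product_mulV : left_inverse one inv mul.
Proof.
move=> x; apply: functional_extensionality_dep => i; exact: mulVg.
Qed.

Lemma group_product_Vmul : right_inverse one inv mul.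
Proof.
move=> x; apply: functional_extensionality_dep => i; exact: mulgV.
Qed.

HB.instance Definition _ := isGroup.Build (group_product H)
  group_product_mulA group_product_mul1 group_product_1mul
  group_product_mulV group_product_Vmul.

End GroupProduct.

Definition arith_partition (K : fieldType) :=
  {fsfun prime_ideal K -> partition with empty_partition}.

Definition arith_tableau (K : fieldType) :=
  {fsfun prime_ideal K -> tableau with empty_tableau}.

Definition arith_shape (K : fieldType) (T : arith_tableau K) :
    arith_partition K :=
  [fsfun q in finsupp T => tableau_shape (T q) | empty_partition].

Definition has_content (K : fieldType) (T : arith_tableau K)
    (la : arith_partition K) : Prop :=
  forall q, tableau_content (T q) = la q.

Definition arith_cocharge (K : fieldType) (T : arith_tableau K) : nat :=
  (\prod_(q <- finsupp T) absolute_norm q ^ tableau_cocharge (T q))%N.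

Section Factored.

Variables (K : fieldType) (L : splittingFieldType K) (C : fieldType).
(* The chosen prime of [L] over each prime of [K].                            *)
Variable pp : prime_ideal K -> prime_ideal L.

Definition GLK := group_product (fun q => [subg local_group (pp q)]).

(* The family [(F q)_q] stands for the tensor product of the [F q].           *)
Definition factored_rep := forall q, representation C (local_group (pp q)).

Section Component.

Variables (q : prime_ideal K) (V : representation C (local_group (pp q))).

Lemma component_rep_subproof1 : V (sgval ((1%g : GLK) q)) = 1%:M.
Proof. exact: repr_mx1. Qed.

Lemma component_rep_subproofM :
  {morph (fun x : GLK => V (sgval (x q))) : x y / (x * y)%g >-> x *m y}.
Proof. by move=> x y; rewrite -repr_mxM ?subgP. Qed.

Definition component_rep : group_rep C GLK :=
  @GroupRep C GLK _ (fun x : GLK => V (sgval (x q)))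
    component_rep_subproof1 component_rep_subproofM.

End Component.

Definition factored_tensor (s : seq (prime_ideal K)) (F : factored_rep) :
    group_rep C GLK :=
  \big[@tensor_rep C GLK/unit_rep C GLK]_(q <- s) component_rep (F q).

(* Outside the support the factors are trivial of dimension one.              *)
Definition arith_schur (mu : arith_partition K) (W : factored_rep) :
    group_rep C GLK :=
  factored_tensor (finsupp mu) (fun q => schur_functor (mu q) (W q)).

Definition arith_Htilde (la : arith_partition K) (W : factored_rep) :
    group_rep C GLK :=
  factored_tensor (finsupp la)
    (fun q => Htilde (la q) (W q) (absolute_norm q)).

Definition W_ (n : nat) (rho : mx_representation C 'Gal({:L} / 1)%G n) :
    factored_rep :=
  fun q => inertia_invariants rho (pp q).

End Factored.

(* Main.v *)
(* Traces turn direct sums into sums and tensor products into products, so    *)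
(* the left-hand side is a finite product over the primes in the support of   *)
(* [la] of finite sums over tableaux. Expanding it by distributivity gives    *)
(* the sum over arithmetic tableaux: as only the empty tableau has empty      *)
(* content, those of content [la] are supported exactly where [la] is.        *)

Require Import Defs.
From mathcomp Require Import all_boot all_order all_algebra all_fingroup.
From mathcomp Require Import all_solvable all_field all_character.
From mathcomp Require Import finmap.
From mathcomp Require Import boolp classical_sets functions cardinality fsbigop.
From mathcomp Require Import reals complex.

Import GRing.Theory Num.Theory.

Set Implicit Arguments.
Unset Strict Implicit.
Unset Printing Implicit Defensive.

Local Open Scope ring_scope.


(** By [trace_factored_tensor] and [trace_Htilde], the trace is a product, over the primes [q] in
    the support of [la], of sums over tableaux of content [la q] weighted by powers of the norm of
    [q]. [prod_sum_fsfun] expands it into a sum over choices of one tableau per prime, and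
    [has_contentP] recognises these choices as the arithmetic tableaux of content [la]. Such a
    tableau, its shape and [la] share one support, so each summand splits into its cocharge times
    the trace of its Schur functor. *)

Lemma trace_grepr_sum (C : fieldType) (gT : finGroupType) (G : {group gT})
    (I : Type) (r : seq I) (P : pred I) (F : I -> representation C G) (g : gT) :
  \tr ((\big[@dadd_grepr C gT G/grepr0]_(i <- r | P i) F i) g) =
  \sum_(i <- r | P i) \tr (F i g).
Proof.
elim/big_rec2: _ => [|i y V _ <-]; first by rewrite /mxtrace big_ord0.
exact: mxtrace_block.
Qed.

Lemma trace_Htilde (C : fieldType) (gT : finGroupType) (G : {group gT})
    (la : Defs.partition) (W : representation C G) (m : nat) (g : gT) :
  \tr (Htilde la W m g) =
  \sum_(T <- fset_set [set T : tableau | tableau_content T = la]%classic)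
    (m ^ tableau_cocharge T)%:R * \tr (schur_functor (tableau_shape T) W g).
Proof.
rewrite /Htilde trace_grepr_sum; apply: eq_bigr => T _.
by rewrite /muln_grepr trace_grepr_sum sumr_const card_ord mulr_natl.
Qed.

Lemma trace_factored_tensor (K : fieldType) (L : splittingFieldType K)
    (C : fieldType) (pp : prime_ideal K -> prime_ideal L)
    (s : seq (prime_ideal K)) (F : factored_rep C pp) (x : GLK pp) :
  trace_rep (factored_tensor s F) x =
  \prod_(q <- s) \tr (F q (sgval (x q))).
Proof.
rewrite /factored_tensor; elim/big_rec2: _ => [|q y V _ <-].
  exact: mxtrace1.
exact: mxtrace_prod.
Qed.

(** Distributivity for finite types, carried over by extension by [d]: a function supported in [D]
    is determined by its restriction to [D]. Some [A i] may contain [d], so the support need not be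
    all of [D]. *)
Lemma prod_sum_fsfun (R : comPzSemiRingType) (I J : choiceType) (d : J)
    (D : {fset I}) (A : I -> {fset J}) (F : I -> J -> R) :
  \prod_(i <- D) \sum_(j <- A i) F i j =
  \sum_(f \in [set f : {fsfun I -> J with d} |
                (finsupp f `<=` D)%fset /\ {in D, forall i, f i \in A i}]%classic)
    \prod_(i <- D) F i (f i).
Proof.
pose X := (\bigcup_(i <- D) A i)%fset.
have AX i : i \in D -> (A i `<=` X)%fset.
  by move=> Di; apply: bigfcup_sup.
pose Q (i : D) := [pred j : X | val j \in A (val i)].
rewrite big_seq_fsetE /=.
(* Distributivity needs one finite type for all inner sums: each is rewritten as a sum over the
   union [X], filtered by membership in [A i]. *)
under eq_bigr => i _.
  rewrite (_ : \sum_(j <- _) _ = \sum_(j : X | Q i j) F (val i) (val j)); last first.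
    rewrite -(big_seq_fsetE _ X (fun j => j \in A (val i)) (F (val i))).
    rewrite -big_filter; apply/perm_big/uniq_perm => [||j].
    - exact: fset_uniq.
    - exact/filter_uniq/fset_uniq.
    - by rewrite mem_filter andb_idr //; apply/fsubsetP/AX/valP.
  over.
rewrite bigA_distr_big_dep /=.
pose h (f : {ffun D -> X}) : {fsfun I -> J with d} :=
  [fsfun i : D => val (f i) | d].
have hE f (i : D) : h f (val i) = val (f i).
  by rewrite /h fsfun_ffun valK.
rewrite (reindex_fsbig h [set` family Q]%classic); last first.
  split.
  - move=> f /= /familyP Qf; split; first exact: finsupp_sub.
    by move=> i Di; rewrite (hE _ [` Di]%fset); apply: Qf.
  - move=> f f' _ _ eqff'; apply/ffunP => i; apply: val_inj.
    by rewrite -!hE eqff'.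
  - move=> g /= [supp_g Ag].
    have gX (i : D) : g (val i) \in X.
      by apply: (fsubsetP (AX _ (valP i))); apply/Ag/valP.
    exists [ffun i => [` gX i]%fset].
      by apply/familyP => i; rewrite ffunE inE /=; apply/Ag/valP.
    apply/fsfunP => i; have [Di|nDi] := boolP (i \in D).
      by rewrite (hE _ [` Di]%fset) ffunE.
    by rewrite !fsfun_dflt //; apply: contra nDi;
      [apply/fsubsetP|apply/fsubsetP/finsupp_sub].
rewrite -(bigfs _ (index_enum_uniq _)); last by move=> f; rewrite mem_index_enum.
apply: eq_bigr => f _; rewrite big_seq_fsetE /=.
by apply: eq_bigr => i _; rewrite hE.
Qed.

Lemma finite_bounded_seq (T : choiceType) (A : set T) (n : nat) :
  finite_set A ->
  finite_set [set s : seq T | (size s <= n)%N /\ {in s, forall x, A x}]%classic.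
Proof.
move=> finA; elim: n => [|n IHn].
  by apply: (sub_finite_set _ (finite_set1 [::])) => -[|x s] [].
apply: (sub_finite_set (B := [set [::]] `|`
    ((fun p => p.1 :: p.2) @` (A `*` [set s : seq T | (size s <= n)%N /\
       {in s, forall x, A x}]))%classic)) => [[|x s] /= [ltsn As]|].
- by left.
- right; exists (x, s) => //=; split; first by apply: As; rewrite mem_head.
  by split=> // y sy; apply: As; rewrite inE sy orbT.
- rewrite finite_setU; split; first exact: finite_set1.
  exact/finite_image/finite_setX.
Qed.

Lemma size_count (M : nat) (s : seq nat) :
  {in s, forall x, 0 < x <= M}%N ->
  size s = (\sum_(i < M) count_mem i.+1 s)%N.
Proof.
elim: s => [|x s IHs] sM /=; first by rewrite big1.
rewrite big_split /= -IHs => [|y sy]; last by rewrite sM // inE sy orbT.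
have /andP[] := sM x (mem_head _ _); case: x {sM} => // x _ ltxM.
rewrite (bigD1 (Ordinal ltxM)) //= eqxx big1 ?addn0 // => i nix.
by rewrite eqSS eq_sym; move: nix; rewrite -val_eqE /= => /negPf->.
Qed.

Lemma tableau_entry_gt0 (T : tableau) :
  {in flatten T, forall x, 0 < x}%N.
Proof.
move=> x /flattenP[r Tr rx]; rewrite lt0n.
have /and4P[_ /allP/(_ r Tr)] := rowsP T.
by move=> + _ _; apply: contraNN => /eqP <-.
Qed.

Lemma tableau_row_gt0 (T : tableau) : {in rows T, forall r, 0 < size r}%N.
Proof.
move=> r Tr; rewrite lt0n; have /and4P[/andP[_]] := rowsP T.
by move=> + _ _ _; apply: contraNN => /eqP <-; apply: map_f.
Qed.

Lemma tableau_entry_le (T : tableau) :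
  {in flatten T, forall x, x <= size (tableau_content T)}%N.
Proof. by move=> x Tx; rewrite size_mkseq; apply: leq_bigmax_seq. Qed.

Lemma size_flatten_tableau (T : tableau) :
  size (flatten T) = sumn (tableau_content T).
Proof.
rewrite (@size_count (size (tableau_content T))) => [|x Tx].
  rewrite sumnE (big_nth 0%N) big_mkord; apply: eq_bigr => i _.
  by rewrite nth_mkseq //; apply: leq_trans (ltn_ord i) _; rewrite size_mkseq.
by rewrite (tableau_entry_gt0 Tx) tableau_entry_le.
Qed.

(** The content bounds the entries by [size c] and fixes their number as [sumn c]; rows being
    nonempty, this bounds both the number of rows and their lengths. Finiteness matters because
    [fset_set] of an infinite set is empty. *)
Lemma finite_content (c : seq nat) :
  finite_set [set T : tableau | tableau_content T = c]%classic.
Proof.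
have fin_entries : finite_set [set x : nat | x <= size c]%N%classic.
  by apply: (sub_finite_set _ (finite_II (size c).+1)).
apply: sub_finite_set (finite_preimage (in2W val_inj)
  (finite_bounded_seq (sumn c) (finite_bounded_seq (sumn c) fin_entries))).
move=> T /= Tc.
have sizeT : sumn (map size T) = sumn c.
  by rewrite -[LHS]size_flatten size_flatten_tableau Tc.
split.
  (* Each row counts for 1, which is at most its length. *)
  rewrite -sizeT -(size_map size) -sum1_size sumnE [leqLHS]big_seq [leqRHS]big_seq.
  by apply: leq_sum => k /mapP[r Tr ->]; apply: (tableau_row_gt0 (T := T)).
move=> r Tr; split=> [|x rx].
  by rewrite -sizeT sumnE big_map (big_rem r) //= leq_addr.
by rewrite -Tc; apply/tableau_entry_le/flattenP; exists r.
Qed.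

Lemma tableau_content_eq0 (T : tableau) :
  tableau_content T = [::] -> T = empty_tableau.
Proof.
move=> T0; apply: val_inj => /=; have := size_flatten_tableau T.
rewrite T0 => /size0nil; have := @tableau_row_gt0 T.
by case: (rows T) => // -[|x r] s // /(_ _ (mem_head _ _)).
Qed.

Lemma tableau_content_empty : tableau_content empty_tableau = [::].
Proof. by rewrite /tableau_content big_nil. Qed.

Lemma finsupp_has_content (K : fieldType) (T : arith_tableau K)
    (la : arith_partition K) : has_content T la -> finsupp T = finsupp la.
Proof.
move=> Tla; apply/fsetP => q; rewrite !mem_finsupp; congr (~~ _).
apply/eqP/eqP => [Tq|laq]; last by apply: tableau_content_eq0; rewrite Tla laq.
by apply: val_inj; rewrite -[LHS]Tla Tq tableau_content_empty.
Qed.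

(** Only the empty tableau has empty shape. *)
Lemma finsupp_arith_shape (K : fieldType) (T : arith_tableau K) :
  finsupp (arith_shape T) = finsupp T.
Proof.
apply/fsetP => q; rewrite mem_finsupp fsfunE; case: ifP; last by rewrite eqxx.
rewrite mem_finsupp => nTq; apply: contraNneq nTq => /(congr1 val) /= Tq.
by apply/eqP/val_inj => /=; apply: size0nil; rewrite -(size_map size) Tq.
Qed.

Lemma has_contentP (K : fieldType) (T : arith_tableau K)
    (la : arith_partition K) :
  has_content T la <->
  (finsupp T `<=` finsupp la)%fset /\
  {in finsupp la, forall q,
    T q \in fset_set [set t : tableau | tableau_content t = la q]%classic}.
Proof.
split=> [Tla|[sTla Tla] q].
  rewrite (finsupp_has_content Tla) fsubset_refl; split=> // q _.
  by rewrite in_fset_set ?inE //=; apply: finite_content.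
have [/Tla|nlaq] := boolP (q \in finsupp la).
  by rewrite in_fset_set ?inE //; apply: finite_content.
(* Outside the support of [la] both sides take their default values, and the empty tableau has empty
   content. *)
rewrite (fsfun_dflt nlaq) fsfun_dflt; first exact: tableau_content_empty.
exact: contra (fsubsetP sTla q) nlaq.
Qed.

Theorem proposition3p26 (R : realType) (K : fieldExtType rat)
    (L : splittingFieldType K) (galLK : galois 1 {:L})
    (n : nat) (rho : mx_representation R[i] 'Gal({:L} / 1)%G n)
    (la : arith_partition K)
    (pp : prime_ideal K -> prime_ideal L)
    (pp_over : forall q, lies_over (pp q) q)
    (sigmaK : GLK pp)
    (sigmaK_frob : forall q,
        is_frobenius (absolute_norm q) (sgval (sigmaK q))) :
  trace_rep (arith_Htilde la (W_ pp rho)) sigmaK =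
  \sum_(T \in [set T : arith_tableau K | has_content T la]%classic)
    (arith_cocharge T)%:R *
    trace_rep (arith_schur (arith_shape T) (W_ pp rho)) sigmaK.
Proof.
rewrite trace_factored_tensor; under eq_bigr do rewrite trace_Htilde.
rewrite (prod_sum_fsfun empty_tableau).
rewrite (eq_fsbigl _ _ _ (_ : _ = [set T | has_content T la]%classic)); last first.
  by apply/predeqP => T; apply: iff_sym; apply: has_contentP.
apply: eq_fsbigr => T; rewrite inE => /= Tla.
rewrite trace_factored_tensor finsupp_arith_shape /arith_cocharge.
(* All three products now run over the support of [la], so the two on the right merge and the
   factors are compared prime by prime. *)
rewrite (finsupp_has_content Tla) natr_prod -big_split /=.
apply: eq_big_seq => q laq.
by rewrite fsfunE (finsupp_has_content Tla) laq.
Qed.
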